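(* Let $m,n\ge1$ be integers and let $\mathcal B(m,n)$ be their closed exponent box. For $z\in\mathcal B(m,n)$ define $z^\sharp:=mn/z$. Then $z^\sharp\in\mathcal B(m,n)$, $(z^\sharp)^\sharp=z$, $$\log z+\log z^\sharp=\log m+\log n,$$ and $$d(z)\,d(z^\sharp)\ge d(m)\,d(n).$$
   Context: $d(n)$ denotes the number of positive divisors of $n$. For $m=\prod_p p^{a_p}$ and $n=\prod_p p^{b_p}$ (products over all primes, finitely many nonzero exponents), the closed exponent box is $$\mathcal B(m,n)=\Bigl\{\prod_p p^{e_p}:\ \min(a_p,b_p)\le e_p\le\max(a_p,b_p)\text{ for all primes }p\Bigr\}.$$ *)

(* Defs.v *)
From mathcomp Require Import all_boot all_order all_algebra.
From mathcomp Require Import all_classical all_reals all_analysis.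

Set Implicit Arguments.
Unset Strict Implicit.
Unset Printing Implicit Defensive.

Local Open Scope classical_set_scope.
Local Open Scope nat_scope.

(* Number of positive divisors (only meaningful for 0 < n:
   [divisors 0] is the empty list). *)
Definition num_divisors (n : nat) : nat := size (divisors n).

(* The exponents of p in m and n are [logn p m] and [logn p n]. The product is
   the finitely supported iterated product of [fsbigop], taken over the set of
   all primes; for 0 < m and 0 < n the bounds on [e] force [e p = 0] for all
   but finitely many primes p, so the support is finite. *)
Definition exponent_box (m n : nat) : set nat :=
  [set \big[muln/1]_(p \in [set p : nat | prime p]) (p ^ e p)
    | e in [set e : nat -> nat | forall p, prime p ->
        minn (logn p m) (logn p n) <= e p <= maxn (logn p m) (logn p n)]].

(* [%/] is Euclidean division on nat: this is the rational quotient mn / z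
   exactly when [z %| m * n]. *)
Definition sharp (m n z : nat) : nat := m * n %/ z.

(* Main.v *)
Require Import Defs.
From mathcomp Require Import all_boot all_order all_algebra.
From mathcomp Require Import all_classical all_reals all_analysis.
From mathcomp Require Import zify.

(** For a prime [p] let [a], [b], [e] be its exponents in [m], [n], [z], so that
    its exponent in [mn / z] is [a + b - e], which lies between [a] and [b]
    exactly when [e] does. As [d] is the product over the primes of
    (exponent + 1), the divisor inequality reduces to one prime at a time, where
    it says that [(e - a) (b - e) >= 0]. *)

(** Multiplication maps pairs of a divisor [x] of [a] and a divisor [y] of [b] bijectively onto the
    divisors of [a * b]: by coprimality, [x] and [y] are recovered from [x * y] as its gcds with [a]
    and [b]. *)
Lemma num_divisorsM (a b : nat) : (0 < a)%N -> (0 < b)%N -> coprime a b ->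
  num_divisors (a * b) = (num_divisors a * num_divisors b)%N.
Proof.
move=> a0 b0 cab; rewrite /num_divisors -(size_allpairs muln).
apply/perm_size/uniq_perm; first exact: divisors_uniq.
- apply: allpairs_uniq; try exact: divisors_uniq.
  have gcd_l x y : x %| a -> y %| b -> gcdn a (x * y) = x.
    move=> xa yb; rewrite Gauss_gcdl; first exact/gcdn_idPr.
    exact: coprime_dvdr yb cab.
  have gcd_r x y : x %| a -> y %| b -> gcdn b (x * y) = y.
    move=> xa yb; rewrite Gauss_gcdr; first exact/gcdn_idPr.
    by apply: coprime_dvdr xa _; rewrite coprime_sym.
  move=> xy xy2 /allpairsP[[u v] /= [ua vb ->]].
  move=> /allpairsP[[u' v'] /= [u'a v'b ->]] /= uv.
  rewrite -!dvdn_divisors // in ua vb u'a v'b.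
  have := (gcd_l u v ua vb, gcd_r u v ua vb).
  by rewrite uv gcd_l // gcd_r // => -[-> ->].
move=> d; rewrite -dvdn_divisors ?muln_gt0 ?a0 //.
apply/idP/allpairsP => [dab | [[x y] /= [xa yb ->]]]; last first.
  by rewrite -!dvdn_divisors // in xa yb; exact: dvdn_mul.
exists (gcdn d a, gcdn d b); split=> /=.
- by rewrite -dvdn_divisors // dvdn_gcdr.
- by rewrite -dvdn_divisors // dvdn_gcdr.
apply/eqP; rewrite eqn_dvd; apply/andP; split.
  rewrite muln_gcdr dvdn_gcd dvdn_mull // muln_gcdl dvdn_gcd dab.
  by rewrite dvdn_mulr.
rewrite Gauss_dvd ?dvdn_gcdl //.
exact: coprime_dvdl (dvdn_gcdr _ _) (coprime_dvdr (dvdn_gcdr _ _) cab).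
Qed.

Lemma num_divisors_pfactor (p k : nat) : prime p -> num_divisors (p ^ k) = k.+1.
Proof.
move=> pp; rewrite /num_divisors -[RHS](size_iota 0) -[RHS](size_map (expn p)).
apply/perm_size/uniq_perm; first exact: divisors_uniq.
  by rewrite map_inj_uniq ?iota_uniq //; exact/expnI/prime_gt1.
move=> d; rewrite -dvdn_divisors ?expn_gt0 ?prime_gt0 //.
apply/(dvdn_pfactor _ _ pp)/mapP => -[i ik ->]; exists i => //.
  by rewrite mem_iota.
by rewrite mem_iota in ik.
Qed.

Section PrimePowerProduct.
Implicit Types (e : nat -> nat) (n N p q : nat).

Lemma prod_pfactor_gt0 e N : (0 < \prod_(0 <= p < N | prime p) p ^ e p)%N.
Proof. by apply: prodn_cond_gt0 => p pp; rewrite expn_gt0 prime_gt0. Qed.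

Lemma logn_prod_pfactor e N q : prime q ->
  logn q (\prod_(0 <= p < N | prime p) p ^ e p) = (if (q < N)%N then e q else 0).
Proof.
move=> pq; elim: N => [|N IH]; first by rewrite big_geq // logn1.
rewrite big_mkcond big_nat_recr //= -big_mkcond /=.
case: ifP => [pN|nN].
  rewrite lognM ?prod_pfactor_gt0 ?expn_gt0 ?prime_gt0 // IH lognX.
  rewrite logn_prime // ltnS [(q <= N)%N]leq_eqVlt.
  by case: (eqVneq q N) => [->|_] /=; rewrite ?ltnn ?muln1 ?muln0 ?addn0.
rewrite muln1 IH ltnS [(q <= N)%N]leq_eqVlt.
by case: (eqVneq q N) => // qN; rewrite -qN pq in nN.
Qed.

Lemma num_divisors_prod_pfactor e N :
  num_divisors (\prod_(0 <= p < N | prime p) p ^ e p)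
    = \prod_(0 <= p < N | prime p) (e p).+1.
Proof.
elim: N => [|N IH]; first by rewrite !big_geq.
rewrite big_mkcond [RHS]big_mkcond !big_nat_recr //= -!big_mkcond /=.
case: ifP => pN; last by rewrite !muln1.
rewrite num_divisorsM ?prod_pfactor_gt0 ?expn_gt0 ?prime_gt0 //.
  by rewrite IH num_divisors_pfactor.
(* The partial product only involves primes below [N], so its exponent at [N] is 0. *)
rewrite coprime_sym coprimeXl // prime_coprime //.
rewrite -{1}(expn1 N) pfactor_dvdn ?prod_pfactor_gt0 //.
by rewrite logn_prod_pfactor // ltnn.
Qed.

(** A prime at or beyond [N] exceeds [n], so cutting the factorization of [n] off at [N] loses
    nothing. *)
Lemma prod_pfactor_logn n N : (0 < n)%N -> (n < N)%N ->
  \prod_(0 <= p < N | prime p) p ^ logn p n = n.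
Proof.
move=> n0 nN; apply: eqn_from_log => //; first exact: prod_pfactor_gt0.
move=> q; case: (boolP (prime q)) => pq; last first.
  (* [eqn_from_log] compares exponents at every [q], and [logn q] is 0 by convention when [q] is not
     prime. *)
  by have log0 x : logn q x = 0 by [rewrite lognE (negPf pq)]; rewrite !log0.
rewrite logn_prod_pfactor //; case: ltnP => // Nq.
by rewrite ltn_log0 // (leq_trans nN).
Qed.

Lemma num_divisors_logn n N : (0 < n)%N -> (n < N)%N ->
  num_divisors n = \prod_(0 <= p < N | prime p) (logn p n).+1.
Proof.
by move=> n0 nN; rewrite -{1}(prod_pfactor_logn n N) // num_divisors_prod_pfactor.
Qed.

(** Bridge from the finitely supported product in [exponent_box] to an ordinary finite one, on which
    induction is possible. *)
Lemma fsbig_prime_pfactor e N : (forall p, prime p -> (N <= p)%N -> e p = 0) ->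
  \big[muln/1%N]_(p \in [set p : nat | prime p]%classic) (p ^ e p)%N
    = \prod_(0 <= p < N | prime p) p ^ e p.
Proof.
move=> e0; apply/esym/bigfs => [|p pp]; first exact: iota_uniq.
by rewrite mem_index_iota /= -leqNgt => Np; rewrite e0.
Qed.

End PrimePowerProduct.

Lemma dvdn_from_log (m n : nat) : (0 < m)%N -> (0 < n)%N ->
  (forall p, prime p -> (logn p m <= logn p n)%N) -> m %| n.
Proof.
move=> m0 n0 le_mn; apply/dvdn_partP => // p.
rewrite mem_primes => /andP[pp _].
by rewrite p_part pfactor_dvdn // le_mn.
Qed.

(** This replaces the existentially quantified exponent function by the exponents of [z] itself, so
    that box membership becomes linear arithmetic at each prime. *)
Lemma exponent_boxP (m n z : nat) : (0 < m)%N -> (0 < n)%N ->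
  exponent_box m n z <-> (0 < z)%N /\ forall p, prime p ->
    (minn (logn p m) (logn p n) <= logn p z <= maxn (logn p m) (logn p n))%N.
Proof.
move=> m0 n0; split=> [[e /= box_e <-]|[z0 box_z]].
  (* As [m] and [n] are positive, such a [p] exceeds both, so the upper bound on [e p] is 0. *)
  have e0 p : prime p -> (m + n <= p)%N -> e p = 0.
    by move=> pp mnp; move: (box_e p pp); rewrite !ltn_log0 ?maxnn; lia.
  rewrite (fsbig_prime_pfactor _ _ e0); split; first exact: prod_pfactor_gt0.
  move=> p pp; rewrite logn_prod_pfactor //; case: ltnP => [_|/(e0 _ pp) <-];
    exact: box_e.
exists (logn^~ z) => //=; rewrite (fsbig_prime_pfactor _ z.+1) => [|p _ zp].
  exact: prod_pfactor_logn.
exact: ltn_log0.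
Qed.

Theorem proposition4p1 (R : realType) (m n : nat) (hm : (1 <= m)%N)
    (hn : (1 <= n)%N) (z : nat) (hz : exponent_box m n z) :
  [/\ (z %| m * n)%N,
      exponent_box m n (sharp m n z),
      sharp m n (sharp m n z) = z,
      (ln (z%:R : R) + ln ((sharp m n z)%:R : R)
        = ln (m%:R : R) + ln (n%:R : R))%R
    & (num_divisors m * num_divisors n
        <= num_divisors z * num_divisors (sharp m n z))%N].
Proof.
have [z0 box_z] := (exponent_boxP m n z hm hn).1 hz.
have mn0 : (0 < m * n)%N by rewrite muln_gt0 hm.
have zmn : z %| m * n.
  (* At each prime, [e <= max(a, b) <= a + b]. *)
  apply: dvdn_from_log => // p pp.
  by rewrite lognM //; move: (box_z p pp); lia.
have zsharp : (z * sharp m n z)%N = (m * n)%N by rewrite mulnC divnK.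
have s0 : (0 < sharp m n z)%N by move: mn0; rewrite -zsharp muln_gt0 z0.
have log_sharp p : (logn p z + logn p (sharp m n z) = logn p m + logn p n)%N.
  by rewrite -!lognM // zsharp.
split=> //.
- apply/exponent_boxP => //; split=> // p pp.
  (* Since [min(a, b) + max(a, b) = a + b], the map sending [e] to [a + b - e] reflects the interval
     onto itself. *)
  by move: (box_z p pp) (log_sharp p); lia.
- by rewrite {1}/sharp -zsharp mulnK.
- by rewrite -!lnM ?Num.Theory.posrE ?Num.Theory.ltr0n // -!GRing.natrM zsharp.
(* All four numbers divide [m * n], so the single cutoff [(m * n).+1] serves for all of them and the
   divisor counts can be compared factor by factor. *)
have lt_mn x : x %| m * n -> (x < (m * n).+1)%N by move/(dvdn_leq mn0).
have smn : sharp m n z %| m * n by rewrite -zsharp dvdn_mull.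
have [mmn nmn] : m %| m * n /\ n %| m * n by rewrite dvdn_mulr ?dvdn_mull.
rewrite !(num_divisors_logn _ (m * n).+1) ?lt_mn //.
rewrite -!big_split /=; apply: leq_prod => p pp.
(* With [s = a + b - e], the difference [(e + 1)(s + 1) - (a + 1)(b + 1)] equals
   [e s - a b = (e - a)(b - e)]. *)
by move: (box_z p pp) (log_sharp p); nia.
Qed.
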